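(* Let $\boldsymbol{\pi}\in\mathcal P^+$, $\boldsymbol\pi\neq\boldsymbol 1$. Then $V(\boldsymbol{\pi})$ is a prime snake module if and only if every pseudo $q$-factorization graph over $\boldsymbol{\pi}$ is totally ordered.
   Context: Let $\mathfrak g$ be a simple complex Lie algebra of type $A_n$, $I=\{1,\dots,n\}$ the nodes of its Dynkin diagram (in the usual linear order), $\mathbb F$ an algebraically closed field of characteristic zero, $q\in\mathbb F^\times$ not a root of unity, and $U_q(\tilde{\mathfrak g})$ the quantum loop algebra of $\mathfrak g$ over $\mathbb F$. For $i\in I$, $a\in\mathbb Z$, let $\boldsymbol\omega_{i,a}$ (a fundamental $\ell$-weight) be the Drinfeld polynomial ($I$-tuple of polynomials in $\mathbb F[u]$) whose only non-constant entry is the $i$-th one, equal to $1-q^au$. Let $\mathcal P^+$ be the (free commutative) multiplicative monoid generated by all $\boldsymbol\omega_{i,a}$, with identity $\boldsymbol 1$. For $\boldsymbol\pi\in\mathcal P^+$, $V(\boldsymbol\pi)$ is the simple finite-dimensional $U_q(\tilde{\mathfrak g})$-module with highest $\ell$-weight $\boldsymbol\pi$. For $i,j\in I$, let $d(i,j)=|i-j|$, let $[i,j]$ be the set of nodes between $i$ and $j$ (inclusive), $\partial I=\{1,n\}$, and $d(J,K)=\min\{d(j,k):j\in J,k\in K\}$. For $r,s\in\mathbb Z_{>0}$ set $\mathscr R_{i,j}^{r,s}=\{r+s+d(i,j)-2p: p\in\mathbb Z,\ -d([i,j],\partial I)\le p<\min\{r,s\}\}$ and $\mathscr R_{i,j}=\mathscr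 R_{i,j}^{1,1}$. For $r\ge 1$ set $\boldsymbol\omega_{i,a,r}=\prod_{p=0}^{r-1}\boldsymbol\omega_{i,a+r-1-2p}$, and let $\mathcal{KR}$ be the set of all $\boldsymbol\omega_{i,a,r}$, $i\in I$, $a\in\mathbb Z$, $r\ge1$. A pseudo $q$-factorization graph is a finite digraph $G=(\mathcal V,\mathcal A)$, $\mathcal V\ne\emptyset$, $\mathcal A\subseteq\mathcal V\times\mathcal V$, with a map $\mathcal F:\mathcal V\to\mathcal{KR}$ such that, whenever $\mathcal F(v)=\boldsymbol\omega_{i,a,r}$ and $\mathcal F(w)=\boldsymbol\omega_{j,b,s}$, one has $(v,w)\in\mathcal A$ if and only if $a-b\in\mathscr R_{i,j}^{r,s}$. It is a pseudo $q$-factorization graph over $\boldsymbol\pi$ if $\prod_{v\in\mathcal V}\mathcal F(v)=\boldsymbol\pi$. Such a digraph has no oriented cycles; $\mathcal V$ is partially ordered by the (reflexive and) transitive extension of: $w<v$ whenever $(v,w)\in\mathcal A$. $G$ is totally ordered if this order is linear. Given $l\ge1$, $\boldsymbol i=(i_1,\dots,i_l)\in I^l$, $\boldsymbol a=(a_1,\dots,a_l)\in\mathbb Z^l$, the pair $(\boldsymbol i,\boldsymbol a)$ is a prime snake if $a_{k+1}-a_k\in\mathscr R_{i_k,i_{k+1}}$ for all $1\le k<l$. A prime snake module is a module $V(\boldsymbol\pi)$ with $\boldsymbol\pi=\prod_{k=1}^l\boldsymbol\omega_{i_k,a_k}$ for some prime snake $(\boldsymbol i,\boldsymbol a)$. 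*)

(* Defs.v *)
From HB Require Import structures.
From mathcomp Require Import all_boot all_order all_algebra.

Set Implicit Arguments.
Unset Strict Implicit.
Unset Printing Implicit Defensive.

Import Order.TTheory GRing.Theory Num.Theory.
Local Open Scope ring_scope.

(* MathComp gives {ffun aT -> R} the pointwise ring structure but leaves out
   its commutativity. *)
HB.instance Definition _ (aT : finType) (R : comPzRingType) :=
  GRing.PzSemiRing_hasCommutativeMul.Build {ffun aT -> R} (@ffun_mulC aT R).

(* The nodes 1, ..., n of the Dynkin diagram are represented by 0, ..., n-1. *)

Definition dist (n : nat) (i j : 'I_n) : nat := ((i - j) + (j - i))%N.

Definition cartan (n : nat) (i j : 'I_n) : int :=
  if i == j then 2 else if dist i j == 1%N then -1 else 0.

Definition node_interval (n : nat) (i j : 'I_n) : {set 'I_n} :=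
  [set k : 'I_n | (minn i j <= k <= maxn i j)%N].

Definition node_boundary (n : nat) : {set 'I_n} :=
  [set k : 'I_n | (val k == 0%N) || ((val k).+1 == n)].

(* Distances between nodes are < n, so the default value n of the minima is
   not attained when J and K are nonempty. *)
Definition dist_sets (n : nat) (J K : {set 'I_n}) : nat :=
  \big[minn/n]_(j in J) \big[minn/n]_(k in K) dist j k.

(* The relation x \in R_{i,j}^{r,s}, meant for r, s > 0. *)
Definition in_R (n : nat) (i j : 'I_n) (r s : nat) (x : int) : Prop :=
  exists p : int,
    [/\ - (dist_sets (node_interval i j) (node_boundary n))%:Z <= p,
        p < (minn r s)%:Z
      & x = r%:Z + s%:Z + (dist i j)%:Z - 2 * p].

Notation lweight F n := {ffun 'I_n -> {poly F}}.

Section LWeights.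
Variables (F : fieldType) (q : F) (n : nat).

Definition fundamental (i : 'I_n) (a : int) : lweight F n :=
  [ffun j => if j == i then 1 - (q ^ a) *: 'X else 1].

Definition in_Pplus (ppi : lweight F n) : Prop :=
  exists s : seq ('I_n * int), ppi = \prod_(x <- s) fundamental x.1 x.2.

Definition KR_weight (i : 'I_n) (a : int) (r : nat) : lweight F n :=
  \prod_(p < r) fundamental i (a + r%:Z - 1 - 2 * p%:Z).

Definition in_KR (w : lweight F n) : Prop :=
  exists (i : 'I_n) (a : int) (r : nat), (0 < r)%N /\ w = KR_weight i a r.

Definition pseudo_qfact_graph
    (T : finType) (A : rel T) (Fm : T -> lweight F n) : Prop :=
  [/\ (0 < #|T|)%N,
      forall v, in_KR (Fm v)
    & forall (v w : T) (i j : 'I_n) (a b : int) (r s : nat),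
        (0 < r)%N -> (0 < s)%N ->
        Fm v = KR_weight i a r -> Fm w = KR_weight j b s ->
        (A v w <-> in_R i j r s (a - b))].

Definition pseudo_qfact_graph_over (ppi : lweight F n)
    (T : finType) (A : rel T) (Fm : T -> lweight F n) : Prop :=
  pseudo_qfact_graph A Fm /\ \prod_(v : T) Fm v = ppi.

Definition prime_snake (l : nat) (i : l.-tuple 'I_n) (a : l.-tuple int) : Prop :=
  forall k k' : 'I_l, val k' = (val k).+1 ->
    in_R (tnth i k) (tnth i k') 1 1 (tnth a k' - tnth a k).

Definition snake_weight (l : nat) (i : l.-tuple 'I_n) (a : l.-tuple int)
    : lweight F n :=
  \prod_(k < l) fundamental (tnth i k) (tnth a k).

End LWeights.

(* connect A v w means w <= v in the order generated by the arrows.  This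
   preorder is antisymmetric because a pseudo q-factorization graph has no
   oriented cycles (all elements of R_{i,j}^{r,s} are positive), so it is
   linear as soon as any two vertices are comparable. *)
Definition totally_ordered (T : finType) (A : rel T) : Prop :=
  forall v w : T, connect A v w \/ connect A w v.

Definition sgz_of (e : bool) : int := if e then 1 else -1.

(* A U_q(loop algebra of sl_{n+1})-module structure on the F-vector space V,
   through Drinfeld's loop presentation.  For the generators
   qx e i r = x^{e}_{i,r} and qpsi e i r = psi^{e}_{i,r} (e = true for +, false
   for -), r ranges over all integers, with psi^+_{i,r} = 0 for r < 0 and
   psi^-_{i,r} = 0 for r > 0.  In terms of the generators k_i^{+-1}, h_{i,s},
     sum_{r >= 0} psi^{+-}_{i,+-r} u^{+-r}
       = k_i^{+-1} exp (+- (q - q^-1) sum_{s > 0} h_{i,+-s} u^{+-s}),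
   and the relations of the h_{j,s} and k_j with the x^{e}_{i,r} amount to
   qpsi_x below. *)
Record qloop_module (F : fieldType) (q : F) (n : nat) (V : vectType F) := QLoop {
  qx : bool -> 'I_n -> int -> 'End(V);
  qpsi : bool -> 'I_n -> int -> 'End(V);
  qpsi_supp : forall e i r, sgz_of e * r < 0 -> qpsi e i r = 0;
  qpsi0_inv : forall e i, (qpsi e i 0 \o qpsi (~~ e) i 0)%VF = \1%VF;
  qpsi_comm : forall e e' i j r s,
    (qpsi e i r \o qpsi e' j s)%VF = (qpsi e' j s \o qpsi e i r)%VF;
  qpsi_x : forall e e' i j r s,
    let c := q ^ (sgz_of e' * cartan i j) in
    (qpsi e i (r + 1) \o qx e' j s)%VF - c *: (qpsi e i r \o qx e' j (s + 1))%VF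
    = c *: (qx e' j s \o qpsi e i (r + 1))%VF - (qx e' j (s + 1) \o qpsi e i r)%VF;
  qx_pm : forall i j r s,
    (qx true i r \o qx false j s)%VF - (qx false j s \o qx true i r)%VF
    = if i == j then
        (q - q^-1)^-1 *: (qpsi true i (r + s) - qpsi false i (r + s))
      else 0;
  qx_x : forall e i j r s,
    let c := q ^ (sgz_of e * cartan i j) in
    (qx e i (r + 1) \o qx e j s)%VF - c *: (qx e j s \o qx e i (r + 1))%VF
    = c *: (qx e i r \o qx e j (s + 1))%VF - (qx e j (s + 1) \o qx e i r)%VF;
  qserre0 : forall e i j r s, cartan i j = 0 ->
    (qx e i r \o qx e j s)%VF = (qx e j s \o qx e i r)%VF;
  qserre1 : forall e i j r1 r2 s, cartan i j = -1 ->
    let S a b :=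
      (qx e i a \o qx e i b \o qx e j s)%VF
      - (q + q^-1) *: (qx e i a \o qx e j s \o qx e i b)%VF
      + (qx e j s \o qx e i a \o qx e i b)%VF in
    S r1 r2 + S r2 r1 = 0
}.

Section Modules.
Variables (F : fieldType) (q : F) (n : nat).

Definition qloop_stable (V : vectType F) (M : qloop_module q n V)
    (U : {vspace V}) : Prop :=
  forall e i r, (qx M e i r @: U <= U)%VS /\ (qpsi M e i r @: U <= U)%VS.

Definition qloop_simple (V : vectType F) (M : qloop_module q n V) : Prop :=
  ({:V} != 0)%VS /\
  forall U : {vspace V}, qloop_stable M U -> U = 0%VS \/ U = {:V}%VS.

(* v is a highest l-weight vector of l-weight ppi: it is killed by all
   x^+_{i,r}, and, with d_i = deg ppi_i,
     psi^{+-}_i(u) v = q^{d_i} (ppi_i(q^-1 u) / ppi_i(q u)) v,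
   the fraction being expanded at u = 0 for psi^+ and at u = oo for psi^-.
   The condition is obtained by clearing the denominator and comparing the
   coefficients of u^m, for m : int. *)
Definition highest_lweight_vector (V : vectType F) (M : qloop_module q n V)
    (ppi : lweight F n) (v : V) : Prop :=
  [/\ v != 0,
      forall i r, qx M true i r v = 0
    & forall e i (m : int),
        \sum_(k < size (ppi i))
           ((ppi i)`_k * q ^+ k) *: qpsi M e i (m - k%:Z) v
        = (q ^+ (size (ppi i)).-1
             * (if m is Posz m' then (ppi i)`_m' * q ^- m' else 0)) *: v].

(* M is (a model of) V(ppi).  Finite-dimensionality is built into vectType. *)
Definition is_simple_lweight_module (V : vectType F) (M : qloop_module q n V)
    (ppi : lweight F n) : Prop :=
  qloop_simple M /\ exists v : V, highest_lweight_vector M ppi v.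

Definition prime_snake_module (V : vectType F) (M : qloop_module q n V) : Prop :=
  exists (l : nat) (i : l.-tuple 'I_n) (a : l.-tuple int),
    [/\ (0 < l)%N, prime_snake i a
      & is_simple_lweight_module M (snake_weight q i a)].

End Modules.

(* Main.v *)
Require Import Defs.
From HB Require Import structures.
From mathcomp Require Import all_boot all_order all_algebra.
From mathcomp Require Import zify ring.
From Stdlib Require Import Classical.

Set Implicit Arguments.
Unset Strict Implicit.
Unset Printing Implicit Defensive.

Import Order.TTheory GRing.Theory Num.Theory.
Local Open Scope ring_scope.

(** Both implications become statements about finite multisets of pairs
(node, exponent), because q is not a root of unity: the fundamental
l-weights then freely generate their monoid ([lweight_of_inj]).  A
Kirillov-Reshetikhin weight is a string of pairs with one node and with
exponents in steps of 2, and a pseudo q-factorization graph over ppi is a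
partition of the multiset of ppi into strings.

A module determines its l-weight.  In a simple module every vector is a
linear combination of the vectors that k lowering operators produce from a
highest l-weight vector v, for varying k.  The product of the psi^+_{i,0},
each raised to the coefficient of its coroot in the sum of the positive
coroots, acts on those of depth k by q^(D - 2k), where q^D is its eigenvalue
on v.  A second highest l-weight vector is an eigenvector of this operator
too, and comparing eigenvalues both ways puts it on the line of v ([highest_vector_line]).  On a given vector the
eigenvalues of psi^+ determine the polynomials, coefficient by coefficient
([lweight_of_vector_unique]).  Hence if V(ppi) is a prime snake module, ppi
itself is the weight of the snake.

Snakes give chains.  Along a prime snake every step raises the exponent by at
least 2.  Two members of a string whose exponents differ by 2 are therefore
neighbours in the snake, and a partition into strings cuts the snake into
consecutive segments.  The step of the snake from the end of one segment to
the beginning of the next yields an arrow between these two strings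
([snake_step_owner]), so all vertices lie on one directed path.

Chains give snakes.  It is enough to look at the finest graph, whose vertices
are the fundamental factors.  Arrows strictly decrease the exponent.  If the
order is linear, neighbours in the list of factors sorted by exponent are
joined by a directed path which has no room for an intermediate vertex, hence
by an arrow, and this is the snake condition ([fundamental_snake]). *)

(** * Unique factorization of l-weights *)

Lemma expfz_inj (F : fieldType) (q : F) (a b : int) : q != 0 ->
  (forall m : nat, (0 < m)%N -> q ^+ m != 1) -> q ^ a = q ^ b -> a = b.
Proof.
move=> q0 qr e; have: q ^ (a - b) = 1.
  by rewrite expfzDr // e -expfzDr // subrr expr0z.
case h: (a - b) => [[|m]|m].
- by move=> _; apply/eqP; rewrite -subr_eq0 h.
- by move/eqP; rewrite -exprnP (negPf (qr m.+1 isT)).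
- by move/eqP; rewrite NegzE -invr_expz invr_eq1 -exprnP (negPf (qr m.+1 isT)).
Qed.

Section Factorizations.
Variables (F : fieldType) (q : F) (n : nat).

Definition lweight_of (s : seq ('I_n * int)) : lweight F n :=
  \prod_(x <- s) fundamental q x.1 x.2.

Definition KR_string (i : 'I_n) (a : int) (r : nat) : seq ('I_n * int) :=
  [seq (i, a + r%:Z - 1 - 2 * p%:Z) | p <- iota 0 r].

Lemma KR_weightE i a r : KR_weight q i a r = lweight_of (KR_string i a r).
Proof.
rewrite /lweight_of big_map -[r in iota 0 r]subn0 -/(index_iota 0 r).
by rewrite big_mkord.
Qed.

Lemma lweight_of_flatten (T : finType) (kr : T -> seq ('I_n * int)) :
  lweight_of (flatten [seq kr v | v <- enum T]) = \prod_(v : T) lweight_of (kr v).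
Proof. by rewrite /lweight_of big_flatten big_map big_enum. Qed.

(** Each component of an l-weight sees only the factors at its own node, which
reduces factorization to polynomials in one variable. *)
Lemma lweight_ofE s j :
  lweight_of s j = \prod_(x <- s | x.1 == j) (1 - (q ^ x.2) *: 'X).
Proof.
rewrite /lweight_of; elim: s => [|x s IH]; first by rewrite !big_nil ffunE.
by rewrite !big_cons ffunE IH ffunE eq_sym; case: ifP => // _; rewrite mul1r.
Qed.

Lemma lweight_of_coef0 s j : (lweight_of s j)`_0 = 1.
Proof.
rewrite -horner_coef0 lweight_ofE horner_prod big1 // => x _.
by rewrite !hornerE ?mulr0 ?subr0.
Qed.

Hypothesis q_neq0 : q != 0.
Hypothesis q_nroot : forall m : nat, (0 < m)%N -> q ^+ m != 1.

Lemma root_fundamental a b : root (1 - (q ^ a) *: 'X) (q ^ (- b)) = (a == b).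
Proof.
rewrite /root !hornerE -expfzDr // subr_eq0 eq_sym -(expr0z q).
apply/eqP/eqP => [/(expfz_inj q_neq0 q_nroot) h|->]; first by lia.
by rewrite subrr.
Qed.

Lemma root_lweight_of s i a : root (lweight_of s i) (q ^ (- a)) = ((i, a) \in s).
Proof.
rewrite lweight_ofE /root horner_prod prodf_seq_eq0.
apply/hasP/idP => [[x xs /andP[/eqP <-]]|ias].
  by rewrite -/(root _ _) root_fundamental => /eqP <-; case: x xs.
by exists (i, a) => //=; rewrite -/(root _ _) root_fundamental !eqxx.
Qed.

Lemma lweight_of_perm s t : perm_eq s t -> lweight_of s = lweight_of t.
Proof. exact: perm_big. Qed.

(** The exponents at a node are read off the roots; a common factor found in
this way is cancelled, which needs one component at a time, since tuples of
polynomials have zero divisors. *)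
Lemma lweight_of_inj s t : lweight_of s = lweight_of t -> perm_eq s t.
Proof.
elim: s t => [|x s IH] t est.
  case: t est => // y t /ffunP/(_ y.1) est.
  have := root_lweight_of [::] y.1 y.2.
  by rewrite est root_lweight_of in_nil -surjective_pairing mem_head.
have xt : x \in t.
  rewrite [x]surjective_pairing -root_lweight_of -est root_lweight_of.
  by rewrite -surjective_pairing mem_head.
rewrite perm_sym (perm_trans (perm_to_rem xt)) // perm_cons perm_sym.
apply: IH; have {}est : lweight_of (x :: s) = lweight_of (x :: rem x t).
  by rewrite est; apply/lweight_of_perm/perm_to_rem.
apply/ffunP => j; have /ffunP/(_ j) := est.
rewrite !lweight_ofE !big_cons; case: ifP => // _; apply: mulfI.
apply/eqP => /(congr1 (fun p : {poly F} => p.[0])) /eqP.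
by rewrite !hornerE ?mulr0 ?subr0 oner_eq0.
Qed.

End Factorizations.

(** * Snakes and chains of strings *)

Section Combinatorics.
Variable n : nat.
Implicit Types i j : 'I_n.

Definition boundary_depth i j : nat :=
  dist_sets (node_interval i j) (node_boundary n).

Lemma boundary_depthC i j : boundary_depth i j = boundary_depth j i.
Proof. by rewrite /boundary_depth /node_interval minnC maxnC. Qed.

Lemma distC i j : dist i j = dist j i.
Proof. exact: addnC. Qed.

(** A boolean form of the relation for r = s = 1, since arrows are boolean; the
index t is -p. *)
Definition in_R11 i j (x : int) : bool :=
  [exists t : 'I_(boundary_depth i j).+1, x == 2 + (dist i j)%:Z + 2 * t%:Z].

Lemma in_R11P i j x : reflect (in_R i j 1 1 x) (in_R11 i j x).
Proof.
apply: (iffP existsP) => [[t /eqP ->]|[p [p1 p2 ->]]].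
  exists (- t%:Z); rewrite -/(boundary_depth i j).
  by have := ltn_ord t; split; lia.
rewrite -/(boundary_depth i j) minnn in p1 p2.
have tP : (`|p| < (boundary_depth i j).+1)%N by lia.
by exists (Ordinal tP); apply/eqP => /=; lia.
Qed.

Lemma in_RC i j r s x : in_R i j r s x -> in_R j i s r x.
Proof.
case=> p [p1 p2 ->]; exists p; rewrite -/(boundary_depth _ _) boundary_depthC.
by rewrite minnC distC; split; [exact: p1|exact: p2|lia].
Qed.

(** This one bound makes snakes strictly increasing and forbids cycles. *)
Lemma in_R_ge2 i j x : in_R i j 1 1 x -> 2 <= x.
Proof. by case=> p [_ p2 ->]; rewrite minnn in p2; lia. Qed.

(** A string with centre a and length r has exponents from a - (r - 1) to
a + (r - 1).  The hypothesis compares the top of the lower string with the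
bottom of the upper one; the same p serves for the centres. *)
Lemma in_R_glue i j a b (r s : nat) : (0 < r)%N -> (0 < s)%N ->
  in_R i j 1 1 ((b - (s%:Z - 1)) - (a + (r%:Z - 1))) -> in_R i j r s (b - a).
Proof. 
move=> r0 s0 [p [p1 p2 e]]; exists p; split => //; last by lia.
by rewrite minnn in p2; lia.
Qed.

Lemma mem_KR_string i a r x :
  reflect (exists2 p, (p < r)%N & x = (i, a + r%:Z - 1 - 2 * p%:Z))
          (x \in KR_string i a r).
Proof.
apply: (iffP mapP) => [[p]|[p pr ->]]; last by exists p; rewrite ?mem_iota.
by rewrite mem_iota => /= pr ->; exists p.
Qed.

Section SnakeToGraph.
Variables (l : nat) (f : 'I_l -> 'I_n * int).
Hypothesis f_snake : forall k k' : 'I_l, val k' = (val k).+1 ->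
  in_R (f k).1 (f k').1 1 1 ((f k').2 - (f k).2).

Lemma snake_growth (k k' : 'I_l) : (k <= k')%N ->
  (f k).2 + 2 * (k' - k)%N%:Z <= (f k').2.
Proof.
case: k' => k' k'l /=; elim: k' k'l => [|m IH] ml km.
  suff -> : k = Ordinal ml by rewrite /=; lia.
  by apply: val_inj => /=; lia.
have [e|lt] := eqVneq (k : nat) m.+1.
  suff -> : k = Ordinal ml by rewrite /=; lia.
  exact: val_inj.
have km' : (k <= m)%N by lia.
have := IH (ltnW ml) km'.
have := in_R_ge2 (@f_snake (Ordinal (ltnW ml)) (Ordinal ml) erefl).
by lia.
Qed.

Lemma snake_lt (k k' : 'I_l) : ((f k).2 < (f k').2) = (k < k')%N.
Proof.
by case: (leqP k' k) => /[dup] h; [have := snake_growth h|have := snake_growth (ltnW h)]; lia.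
Qed.

Lemma snake_inj : injective f.
Proof.
move=> k k' e; apply: val_inj; apply/eqP.
have := snake_lt k k'; have := snake_lt k' k; rewrite e ltxx /=; lia.
Qed.

Variables (T : finType) (A : rel T).
Variables (i : T -> 'I_n) (a : T -> int) (r : T -> nat).
Hypothesis r_gt0 : forall v, (0 < r v)%N.
Hypothesis AP : forall v w, in_R (i v) (i w) (r v) (r w) (a v - a w) -> A v w.
Hypothesis f_perm :
  perm_eq (flatten [seq KR_string (i v) (a v) (r v) | v <- enum T]) (codom f).

Let string v := KR_string (i v) (a v) (r v).

Lemma mem_codom_string x : x \in codom f -> exists v, x \in string v.
Proof.
by rewrite -(perm_mem f_perm) => /flatten_mapP[v _ xv]; exists v.
Qed.

Lemma string_sub_codom v x : x \in string v -> x \in codom f.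
Proof.
by move=> xv; rewrite -(perm_mem f_perm); apply/flatten_mapP; exists v; rewrite ?mem_enum.
Qed.

(** The entries of a snake are distinct, so no multiplicity is left for two
strings to share. *)
Lemma string_disjoint v w x : x \in string v -> x \in string w -> v = w.
Proof.
move=> xv xw; apply/eqP/negPn/negP => vw.
have : count_mem x (flatten [seq string v | v <- enum T]) = count_mem x (codom f).
  by have /permP := f_perm.
have f_uniq : uniq (codom f) by rewrite (map_inj_uniq snake_inj) enum_uniq.
rewrite (count_uniq_mem x f_uniq).
rewrite count_flatten -map_comp sumnE big_map big_enum /=.
rewrite (bigD1 v) //= (bigD1 w) 1?eq_sym //=.
have : (0 < count_mem x (string v))%N by rewrite -has_count has_pred1.
have : (0 < count_mem x (string w))%N by rewrite -has_count has_pred1.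
by case: (x \in codom f) => /=; lia.
Qed.

(** If two neighbours of the snake lie in different strings, the lower one is
the top of its string: the next member of that string would be an entry of
the snake whose exponent is larger by only 2, hence the upper neighbour
itself.  In the same way the upper one is the bottom of its string, and the
step between them is an arrow. *)
Lemma snake_step_owner (k k' : 'I_l) v w : val k' = (val k).+1 ->
  f k \in string v -> f k' \in string w -> v = w \/ A w v.
Proof.
move=> /= kk' kv kw; have [->|/eqP vw] := eqVneq v w; [by left|right].
have step := in_R_ge2 (f_snake kk').
have Nv : f k' \notin string v by apply/negP => /string_disjoint /(_ kw).
have Nw : f k \notin string w by apply/negP => h; apply/vw/(string_disjoint kv h).
case/mem_KR_string: (kv) => p pr fk; case/mem_KR_string: (kw) => p' pr' fk'.
(* p counts from the top of the string, p' from the top of the other one. *)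
have p0 : p = 0%N.
  case: p pr fk => // p pr fk; case/negP: Nv.
  have up : (i v, a v + (r v)%:Z - 1 - 2 * p%:Z) \in string v.
    by apply/mem_KR_string; exists p => //; lia.
  have /codomP[m fm] := string_sub_codom up.
  suff -> : k' = m by rewrite -fm.
  have := snake_lt k m; have := snake_lt k' m.
  rewrite -fm fk /= in step *; move=> h1 h2; apply: val_inj; rewrite /= kk'.
  by lia.
have ps : p'.+1 = r w.
  apply/eqP; rewrite eqn_leq pr' /= leqNgt; apply/negP => pr2; case/negP: Nw.
  have dn : (i w, a w + (r w)%:Z - 1 - 2 * p'.+1%:Z) \in string w.
    by apply/mem_KR_string; exists p'.+1.
  have /codomP[m fm] := string_sub_codom dn.
  suff -> : k = m by rewrite -fm.
  have := snake_lt m k'; have := snake_lt m k.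
  rewrite -fm fk' /= in step *; move=> h1 h2; apply: val_inj => /=.
  by lia.
apply/AP/in_RC/in_R_glue => //.
have := f_snake kk'; rewrite fk fk' p0 -ps /=; congr (in_R _ _ _ _ _); lia.
Qed.

Lemma snake_connect_owner (k k' : 'I_l) v w : (k <= k')%N ->
  f k \in string v -> f k' \in string w -> connect A w v.
Proof.
case: k' => k' k'l /=; elim: k' k'l w => [|m IH] ml w km kv kw.
  have kE : k = Ordinal ml by apply: val_inj => /=; lia.
  by rewrite kE in kv; rewrite (string_disjoint kv kw).
have [e|lt] := eqVneq (k : nat) m.+1.
  have kE : k = Ordinal ml by apply: val_inj.
  by rewrite kE in kv; rewrite (string_disjoint kv kw).
have km' : (k <= m)%N by lia.
have [u ku] := mem_codom_string (codom_f f (Ordinal (ltnW ml))).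
have ut := IH _ _ km' kv ku.
have [<- //|wu] := @snake_step_owner (Ordinal (ltnW ml)) (Ordinal ml) u w erefl ku kw.
exact: connect_trans (connect1 wu) ut.
Qed.

Lemma snake_totally_ordered : totally_ordered A.
Proof.
have own v : exists k, f k \in string v.
  have h : (i v, a v + (r v)%:Z - 1 - 2 * 0%:Z) \in string v.
    by apply/mem_KR_string; exists 0%N.
  by have /codomP[k fk] := string_sub_codom h; exists k; rewrite -fk.
move=> v w; have [k kv] := own v; have [k' kw] := own w.
case: (leqP k k') => h; [right|left]; first exact: snake_connect_owner h kv kw.
exact: snake_connect_owner (ltnW h) kw kv.
Qed.

End SnakeToGraph.

Section GraphToSnake.
Variables (l : nat) (f : 'I_l -> 'I_n * int).
Hypothesis f_sorted : forall k k' : 'I_l, (k <= k')%N -> (f k).2 <= (f k').2.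

Definition fundamental_arrow : rel 'I_l :=
  fun v w => in_R11 (f v).1 (f w).1 ((f v).2 - (f w).2).

Lemma fundamental_connect v w : connect fundamental_arrow v w -> v != w ->
  exists u, [/\ fundamental_arrow v u, connect fundamental_arrow u w
              & (f w).2 <= (f u).2 < (f v).2].
Proof.
case/connectP => p; elim: p v w => [|u p IH] v w /=.
  by move=> _ ->; rewrite eqxx.
case/andP=> vu up ew vw; exists u; split => //; first by apply/connectP; exists p.
have := in_R_ge2 (in_R11P _ _ _ vu).
have [->|uw] := eqVneq u w; first by lia.
by have [u' [_ _]] := IH u w up ew uw; lia.
Qed.

(** A path from k + 1 to k starts with an arrow to a vertex u of exponent below
that of k + 1, so u <= k by sortedness; and u = k, because otherwise the
rest of the path would make the exponent of u exceed that of k.  A path in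
the other direction would have to increase the exponent. *)
Lemma fundamental_snake : totally_ordered fundamental_arrow ->
  forall k k' : 'I_l, val k' = (val k).+1 ->
  in_R (f k).1 (f k').1 1 1 ((f k').2 - (f k).2).
Proof.
move=> tot k k' /= kk'; have kk : (k <= k')%N by lia.
have neq : k != k' by apply/eqP => e; rewrite e in kk'; lia.
have le := f_sorted kk.
have lt_index (u v : 'I_l) : (f u).2 < (f v).2 -> (u < v)%N.
  by rewrite ltnNge => h; apply/negP => /f_sorted; lia.
case: (tot k k') => [/fundamental_connect/(_ neq)[u [_ _]]|]; first by lia.
rewrite eq_sym in neq; case/fundamental_connect/(_ neq) => u [ku uk /andP[_ uk']].
have {}uk' := lt_index _ _ uk'.
have [e|nuk] := eqVneq u k; first by rewrite e in ku; apply/in_RC/in_R11P.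
have [t [_ _ /andP[h1 h2]]] := fundamental_connect uk nuk.
by have := lt_index k u (le_lt_trans h1 h2); lia.
Qed.

End GraphToSnake.
End Combinatorics.

(** * Vector spaces *)

Lemma memvZ_neq0 (F : fieldType) (V : vectType F) (U : {vspace V}) c w :
  c != 0 -> (c *: w \in U) = (w \in U).
Proof. by move=> c0; rewrite rpredZeq (negPf c0). Qed.

Lemma scale_vector_inj (F : fieldType) (V : vectType F) (v : V) :
  v != 0 -> injective (fun c : F => c *: v).
Proof.
move=> v0 a b /eqP; rewrite -subr_eq0 -scalerBl scaler_eq0 (negPf v0) orbF.
by rewrite subr_eq0 => /eqP.
Qed.

(** A submodule given by a predicate, such as the span of infinitely many
vectors, is a vector subspace in the sense required by simplicity: take a
subspace contained in it of the largest possible dimension. *)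
Lemma vspace_of_pred (F : fieldType) (V : vectType F) (P : V -> Prop) :
  P 0 -> (forall c u w, P u -> P w -> P (c *: u + w)) ->
  exists U : {vspace V}, forall w, w \in U <-> P w.
Proof.
move=> P0 Plin.
have extend (U : {vspace V}) : (forall w, w \in U -> P w) ->
    (forall w, w \in U <-> P w) \/ (exists2 w, P w & w \notin U).
  move=> UP; have [|nex] := classic (exists2 w, P w & w \notin U); first by right.
  by left => w; split=> [/UP //|Pw]; apply/negPn/negP => wU; apply: nex; exists w.
suff H m (U : {vspace V}) : (\dim {:V} <= m + \dim U)%N ->
    (forall w, w \in U -> P w) -> exists U' : {vspace V}, forall w, w \in U' <-> P w.
  by apply: (H (\dim {:V}) 0%VS); rewrite ?leq_addr // => w; rewrite memv0 => /eqP ->.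
elim: m U => [|m IH] U dU UP; have [UE|[w Pw wU]] := extend U UP; try by exists U.
  case/negP: wU; suff -> : U = fullv by rewrite memvf.
  by apply/eqP; rewrite eqEdim subvf.
apply: (IH (<[w]> + U)%VS) => [|_ /memv_addP[_ /vlineP[c ->] [u uU ->]]].
  apply: (leq_trans dU); rewrite addSnnS leq_add2l ltn_neqAle dimvS ?addvSr // andbT.
  apply: contra wU => /eqP dUU.
  have /eqP -> : (U == <[w]> + U)%VS by rewrite eqEdim addvSr -dUU /=.
  by rewrite (subvP (addvSl _ _)) ?memv_line.
exact: Plin (UP _ uU).
Qed.

(** * Highest l-weight vectors *)

Lemma sum_indicator (n a : nat) (g : nat -> int) :
  \sum_(i < n) (i == a :> nat)%:Z * g i = if (a < n)%N then g a else 0.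
Proof.
case: ltnP => an.
  rewrite (bigD1 (Ordinal an)) //= eqxx mul1r big1 ?addr0 // => i.
  by rewrite -val_eqE /= => /negPf ->; rewrite mul0r.
rewrite big1 // => i _; have /negPf -> : (i : nat) != a by have := ltn_ord i; lia.
by rewrite mul0r.
Qed.

(** The coefficients of the sum of the positive coroots of type A_n in the
simple coroots, for nodes numbered from 0. *)
Definition height_coef (n : nat) (i : nat) : nat := (i.+1 * (n - i))%N.

(** The sum of the positive coroots takes the value 2 on every simple root. *)
Lemma height_coef_cartan (n : nat) (j : 'I_n) :
  \sum_(i < n) (height_coef n i)%:Z * cartan i j = 2.
Proof.
(* g vanishes at n, which absorbs the missing neighbour of the last node. *)
pose g (i : nat) : int := (i%:Z + 1) * (n%:Z - i%:Z).
have cE (i : 'I_n) : (height_coef n i)%:Z * cartan i j =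
    2 * ((i == j :> nat)%:Z * g i) - (i == j.+1 :> nat)%:Z * g i
    - (i.+1 == j :> nat)%:Z * g i.
  have ltin := ltn_ord i.
  have gE : (height_coef n i)%:Z = g i.
    by rewrite /g /height_coef PoszM -(subzn (ltnW ltin)) -addn1 PoszD.
  have dE : (dist i j == 1%N) = (i == j.+1 :> nat) || (i.+1 == j :> nat).
    by rewrite /dist; lia.
  rewrite gE /cartan -val_eqE /= dE.
  have [ij|ij|ij] := ltngtP i j.
  - have /negPf -> : (i : nat) != j.+1 by lia.
    by case: (i.+1 == j :> nat); rewrite /=; ring.
  - have /negPf -> : i.+1 != j by lia.
    by case: (i == j.+1 :> nat); rewrite /=; ring.
  - have /negPf -> : (i : nat) != j.+1 by lia.
    have /negPf -> : i.+1 != j by lia.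
    by rewrite /=; ring.
rewrite (eq_bigr _ (fun i _ => cE i)) !sumrB -mulr_sumr !sum_indicator ltn_ord.
have -> : (if (j.+1 < n)%N then g j.+1 else 0) = g j.+1.
  case: ltnP => // nj; rewrite /g (_ : n%:Z - j.+1%:Z = 0) ?mulr0 //.
  by have := ltn_ord j; lia.
have -> : \sum_(i < n) (i.+1 == j :> nat)%:Z * g i = j%:Z * (n%:Z - j%:Z + 1).
  case: j {cE} => [[|j] jn] /=.
    by rewrite big1 ?mul0r // => i _; rewrite mul0r.
  under eq_bigr do rewrite eqSS.
  by rewrite sum_indicator (ltnW jn) /g intS; ring.
by rewrite /g intS; ring.
Qed.

Section HighestWeight.
Variables (F : fieldType) (q : F) (n : nat).
Hypothesis q_neq0 : q != 0.
Hypothesis q_nroot : forall m : nat, (0 < m)%N -> q ^+ m != 1.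
Variables (V : vectType F) (M : qloop_module q n V).

Notation xm := (qx M false).
Notation xp := (qx M true).
Notation psi := (qpsi M).

Lemma qpsi_plus_neg i r w : r < 0 -> psi true i r w = 0.
Proof. by move=> h; rewrite qpsi_supp ?mul1r // zero_lfunE. Qed.

Lemma qpsi_minus_pos i r w : 0 < r -> psi false i r w = 0.
Proof. by move=> h; rewrite qpsi_supp ?mulN1r ?oppr_lt0 // zero_lfunE. Qed.

(** The exchange relation as a recursion on the index of psi.  For psi^+ it is
used upwards from the index 0, for psi^- downwards. *)
Lemma qpsi_xm e i j r s w : let c := q ^ (- cartan i j) in
  psi e i (r + 1) (xm j s w) = c *: psi e i r (xm j (s + 1) w)
    + (c *: xm j s (psi e i (r + 1) w) - xm j (s + 1) (psi e i r w)).
Proof.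
move=> c; have /lfunP/(_ w) := qpsi_x M e false i j r s.
rewrite /= !(add_lfunE, opp_lfunE, scale_lfunE, comp_lfunE) mulN1r -/c => <-.
by rewrite [RHS]addrC subrK.
Qed.

(** The case r = -1 of the exchange relation, where psi^+_{-1} = 0. *)
Lemma qpsi0_xm i j s w :
  psi true i 0 (xm j s w) = q ^ (- cartan i j) *: xm j s (psi true i 0 w).
Proof.
have := qpsi_xm true i j (-1) s w.
by rewrite /= addNr !(@qpsi_plus_neg _ (-1)) // scaler0 linear0 subr0 add0r.
Qed.

Lemma qx_pmE i j r s w : xp i r (xm j s w) = xm j s (xp i r w) +
  if i == j then (q - q^-1)^-1 *: (psi true i (r + s) w - psi false i (r + s) w) else 0.
Proof.
have /lfunP/(_ w) := qx_pm M i j r s.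
rewrite !(add_lfunE, opp_lfunE, comp_lfunE) => /eqP.
rewrite subr_eq addrC => /eqP ->; congr (_ + _).
by case: eqP; rewrite !(add_lfunE, opp_lfunE, scale_lfunE, zero_lfunE).
Qed.

(** The vectors of depth k below v.  The loop index of a lowering operator runs
over all integers, hence an inductive predicate instead of a finite sum of
subspaces. *)
Inductive descend (v : V) : nat -> V -> Prop :=
| descend_top : descend v 0 v
| descend_zero k : descend v k 0
| descend_xm k j s w : descend v k w -> descend v k.+1 (xm j s w)
| descend_lin k c w1 w2 :
    descend v k w1 -> descend v k w2 -> descend v k (c *: w1 + w2).

Section Descend.
Variable v : V.

Lemma descendD k w1 w2 : descend v k w1 -> descend v k w2 -> descend v k (w1 + w2).
Proof. by rewrite -{2}[w1]scale1r; apply: descend_lin. Qed.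

Lemma descendZ k c w : descend v k w -> descend v k (c *: w).
Proof. by move=> h; rewrite -[_ *: _]addr0; apply: descend_lin h (descend_zero _ _). Qed.

Lemma descendB k w1 w2 : descend v k w1 -> descend v k w2 -> descend v k (w1 - w2).
Proof. by move=> h1 h2; rewrite -scaleN1r; apply/descendD/descendZ. Qed.

Lemma descend0_line w : descend v 0 w -> w \in <[v]>%VS.
Proof.
move k0: 0%N => k h; elim: h k0 => {k w} //.
- by rewrite memv_line.
- by move=> *; rewrite mem0v.
- by move=> k c w1 w2 _ h1 _ h2 k0; rewrite memvD ?memvZ ?h1 ?h2.
Qed.

Lemma line_descend0 w : w \in <[v]>%VS -> descend v 0 w.
Proof. by case/vlineP => c ->; apply/descendZ/descend_top. Qed.

Hypothesis psi_v : forall e i r, descend v 0 (psi e i r v).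
Hypothesis xp_v : forall i r, xp i r v = 0.

(** The relations move psi past a lowering operator at the price of shifting
the indices, so the depth is kept even though no single word is. *)
Lemma descend_psi_xm k w : (forall e i r, descend v k (psi e i r w)) ->
  forall e i r j s, descend v k.+1 (psi e i r (xm j s w)).
Proof.
move=> hw [] i r j s.
  (* The recursion starts at the index -1, where psi^+ vanishes. *)
  have zero (r' : int) : r' < 0 -> descend v k.+1 (psi true i r' (xm j s w)).
    by move=> h; rewrite qpsi_plus_neg //; apply: descend_zero.
  have [/zero //|r0] := ltP r 0.
  have [m ->] : exists m : nat, r = m%:Z - 1 by exists `|(r + 1)%R|%N; lia.
  elim: m s {zero} => [|m IH] s.
    by rewrite qpsi_plus_neg //; apply: descend_zero.
  have -> : m.+1%:Z - 1 = m%:Z - 1 + 1 :> int by lia.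
  rewrite qpsi_xm; apply/descendD/descendB; first exact/descendZ.
    exact/descendZ/descend_xm.
  exact/descend_xm.
(* For psi^- it starts at the index 1. *)
have zero (r' : int) : 0 < r' -> descend v k.+1 (psi false i r' (xm j s w)).
  by move=> h; rewrite qpsi_minus_pos //; apply: descend_zero.
have [/zero //|r0] := ltP 0 r.
have [m ->] : exists m : nat, r = 1 - m%:Z by exists `|(1 - r)%R|%N; lia.
elim: m s {zero} => [|m IH] s.
  by rewrite qpsi_minus_pos //; apply: descend_zero.
have := qpsi_xm false i j (1 - m.+1%:Z) (s - 1) w; rewrite /= subrK.
have -> : 1 - m.+1%:Z + 1 = 1 - m%:Z :> int by lia.
set c := q ^ _ => /(canLR (addrK _)) e.
rewrite -[psi _ _ _ _](scalerK (expfz_neq0 (- cartan i j) q_neq0)) -/c -e.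
apply/descendZ/descendB; first exact: IH.
by apply/descendB; [apply/descendZ|]; apply/descend_xm.
Qed.

Lemma descend_psi k w : descend v k w -> forall e i r, descend v k (psi e i r w).
Proof.
elim=> {k w} [|k|k j s w _ hw|k c w1 w2 _ h1 _ h2] e i r.
- exact: psi_v.
- by rewrite linear0; apply: descend_zero.
- exact: descend_psi_xm hw _ _ _ _ _.
- by rewrite linearP /=; exact: descend_lin (h1 _ _ _) (h2 _ _ _).
Qed.

Lemma descend_xp k w : descend v k w ->
  forall i r, if k is k'.+1 then descend v k' (xp i r w) else xp i r w = 0.
Proof.
elim=> {k w} [|k|k j s w hw IH|k c w1 w2 _ h1 _ h2] i r.
- exact: xp_v.
- by rewrite linear0; case: k => // k; apply: descend_zero.
- rewrite qx_pmE; apply: descendD.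
    case: k hw IH => [|k] hw IH; last exact/descend_xm.
    by rewrite IH linear0; apply: descend_zero.
  case: ifP => _; last exact: descend_zero.
  by apply/descendZ/descendB; apply: descend_psi.
- rewrite linearP /=; case: k h1 h2 => [|k] h1 h2; last exact: descend_lin (h1 _ _) (h2 _ _).
  by rewrite h1 h2 scaler0 addr0.
Qed.

(** The submodule generated by v, once psi maps v into its line and all
raising operators kill v. *)
Inductive generated : V -> Prop :=
| generated_descend k w : descend v k w -> generated w
| generated_lin c w1 w2 : generated w1 -> generated w2 -> generated (c *: w1 + w2).

Lemma generated_qx e i r w : generated w -> generated (qx M e i r w).
Proof.
elim=> {w} [k w hw|c w1 w2 _ h1 _ h2]; last by rewrite linearP /=; apply: generated_lin.
case: e; last exact/generated_descend/descend_xm/hw.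
have := descend_xp hw i r; case: k {hw} => [->|k]; last exact: generated_descend.
exact: generated_descend (descend_zero v 0).
Qed.

Lemma generated_qpsi e i r w : generated w -> generated (psi e i r w).
Proof.
elim=> {w} [k w hw|c w1 w2 _ h1 _ h2]; last by rewrite linearP /=; apply: generated_lin.
exact/generated_descend/descend_psi/hw.
Qed.

Lemma simple_generated : qloop_simple M -> v != 0 -> forall w, generated w.
Proof.
case=> _ simpleM v0.
have [|U UP] := @vspace_of_pred F V generated _ generated_lin.
  exact: generated_descend (descend_zero v 0).
have vU : v \in U by apply/UP/generated_descend/descend_top.
have stU : qloop_stable M U.
  move=> e i r; split; apply/subvP => _ /memv_imgP[w /UP wU ->]; apply/UP.
    exact: generated_qx.
  exact: generated_qpsi.
case: (simpleM U stU) => U0 w; last by apply/UP; rewrite U0 memvf.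
by move: vU; rewrite U0 memv0 (negPf v0).
Qed.

End Descend.

(** The operator whose eigenvalues measure depth: the product of the
psi^+_{i,0}, each taken height_coef times.  The general statement over lists
of nodes avoids powers of operators. *)
Lemma height_operator : exists K : 'End(V),
  (forall j s w, K (xm j s w) = q ^ (- 2%:Z) *: xm j s (K w)) /\
  (forall (e : 'I_n -> int) w, (forall i, psi true i 0 w = q ^ e i *: w) ->
     K w = q ^ (\sum_(i < n) (height_coef n i)%:Z * e i) *: w).
Proof.
have weighted L : exists K : 'End(V),
    (forall j s w, K (xm j s w) = q ^ (- \sum_(i <- L) cartan i j) *: xm j s (K w)) /\
    (forall (e : 'I_n -> int) w, (forall i, psi true i 0 w = q ^ e i *: w) ->
       K w = q ^ (\sum_(i <- L) e i) *: w).
  elim: L => [|i L [K [K1 K2]]].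
    by exists \1%VF; split => [j s w|e w _]; rewrite !lfunE /= big_nil ?oppr0 expr0z scale1r.
  exists (psi true i 0 \o K)%VF; split => [j s w|e w he].
    rewrite !comp_lfunE K1 linearZ /= qpsi0_xm scalerA -expfzDr // big_cons opprD.
    by rewrite [_ + - cartan i j]addrC.
  by rewrite comp_lfunE (K2 e) // linearZ /= he scalerA -expfzDr // big_cons addrC.
pose nodes := flatten [seq nseq (height_coef n i) i | i : 'I_n <- enum 'I_n].
have sum_nodes (e : 'I_n -> int) :
    \sum_(i <- nodes) e i = \sum_(i < n) (height_coef n i)%:Z * e i.
  rewrite /nodes big_flatten big_map big_enum /=; apply: eq_bigr => i _.
  by rewrite big_nseq iter_addr_0 -mulr_natl natz.
have [K [K1 K2]] := weighted nodes.
exists K; split => [j s w|e w he]; first by rewrite K1 sum_nodes height_coef_cartan.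
by rewrite (K2 e) // sum_nodes.
Qed.

Lemma descend_height (K : 'End(V)) v (D : int) :
  (forall j s w, K (xm j s w) = q ^ (- 2%:Z) *: xm j s (K w)) ->
  K v = q ^ D *: v ->
  forall k w, descend v k w -> K w = q ^ (D - 2 * k%:Z) *: w.
Proof.
move=> K_xm Kv k w; elim=> {k w} [|k|k j s w _ IH|k c w1 w2 _ h1 _ h2].
- by rewrite mulr0 subr0.
- by rewrite scaler0 linear0.
- by rewrite K_xm IH linearZ /= scalerA -expfzDr // intS; congr (q ^ _ *: _); ring.
- by rewrite linearP /= h1 h2 scalerDr !scalerA mulrC.
Qed.

(** A multiple of the projection onto depth 0 along the depths 1, ..., N. *)
Fixpoint top_component (K : 'End(V)) (D : int) (N : nat) : 'End(V) :=
  if N is N'.+1 then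
    ((K - (q ^ (D - 2 * N%:Z)) *: \1) \o top_component K D N')%VF
  else \1%VF.

Lemma top_component_eigen (K : 'End(V)) (D : int) N (E : int) w : K w = q ^ E *: w ->
  top_component K D N w = \prod_(k < N) (q ^ E - q ^ (D - 2 * k.+1%:Z)) *: w.
Proof.
move=> Kw; elim: N => [|N IH] /=; first by rewrite big_ord0 scale1r lfunE.
rewrite comp_lfunE IH linearZ /= !(add_lfunE, opp_lfunE, scale_lfunE, id_lfunE) Kw.
by rewrite -scalerBl scalerA big_ord_recr.
Qed.

Lemma top_component_line (K : 'End(V)) v (D : int) :
  (forall j s w, K (xm j s w) = q ^ (- 2%:Z) *: xm j s (K w)) ->
  K v = q ^ D *: v -> forall w, generated v w ->
  exists N0, forall N, (N0 <= N)%N -> top_component K D N w \in <[v]>%VS.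
Proof.
move=> K_xm Kv w; elim=> {w} [k w hw|c w1 w2 _ [N1 h1] _ [N2 h2]].
  exists k => N kN; rewrite (top_component_eigen _ _ (descend_height K_xm Kv hw)).
  case: k hw kN => [|k] hw kN; first by apply/memvZ/descend0_line.
  by rewrite (bigD1 (Ordinal kN)) //= subrr mul0r scale0r mem0v.
exists (maxn N1 N2) => N; rewrite geq_max => /andP[N1N N2N].
by rewrite linearP /= memvD ?memvZ ?h1 ?h2.
Qed.

(** Of two highest vectors let u be the one with the smaller height.  The
other one, u', is generated by u, and the factors of top_component are nonzero
on it because its eigenvalue q^(ht u') differs from q^(ht u - 2k) for k > 0.
So u' lies at depth 0, that is on the line of u. *)
Lemma highest_vector_line v v' (d d' : 'I_n -> int) :
  v != 0 -> v' != 0 -> qloop_simple M ->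
  (forall e i r, psi e i r v \in <[v]>%VS) -> (forall i r, xp i r v = 0) ->
  (forall e i r, psi e i r v' \in <[v']>%VS) -> (forall i r, xp i r v' = 0) ->
  (forall i, psi true i 0 v = q ^ d i *: v) ->
  (forall i, psi true i 0 v' = q ^ d' i *: v') ->
  exists2 c, c != 0 & v' = c *: v.
Proof.
move=> v0 v'0 simpleM psi_v xp_v psi_v' xp_v' dv dv'.
have [K [K_xm K_wt]] := height_operator.
pose ht (e : 'I_n -> int) := \sum_(i < n) (height_coef n i)%:Z * e i.
have higher u u' e e' : u != 0 -> u' != 0 ->
    (forall b i r, psi b i r u \in <[u]>%VS) -> (forall i r, xp i r u = 0) ->
    (forall i, psi true i 0 u = q ^ e i *: u) ->
    (forall i, psi true i 0 u' = q ^ e' i *: u') ->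
    ht e <= ht e' -> u' \in <[u]>%VS.
  move=> u0 u'0 psi_u xp_u eu eu' ee'.
  have psi_u' b i r : descend u 0 (psi b i r u) by apply: line_descend0.
  have gen := simple_generated psi_u' xp_u simpleM u0 u'.
  have [N /(_ N (leqnn N))] := top_component_line K_xm (K_wt _ _ eu) gen.
  rewrite (top_component_eigen _ _ (K_wt _ _ eu')) memvZ_neq0 //.
  apply/prodf_neq0 => k _; rewrite subr_eq0; apply/eqP => /(expfz_inj q_neq0 q_nroot).
  by rewrite -/(ht e) -/(ht e'); lia.
have : v' \in <[v]>%VS.
  have [le|/ltW le] := leP (ht d) (ht d'); first exact: higher dv dv' le.
  have /vlineP[c vE] := higher _ _ _ _ v'0 v0 psi_v' xp_v' dv' dv le.
  have c0 : c != 0 by apply: contraNneq v0 => c0; rewrite vE c0 scale0r.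
  by rewrite vE -[v' in v' \in _](scalerK c0) memvZ ?memv_line.
case/vlineP=> c vE; exists c => //.
by apply: contraNneq v'0 => c0; rewrite vE c0 scale0r.
Qed.

Section LWeightOfVector.
Variables (v : V) (w : lweight F n).
Hypothesis w_0 : forall i, (w i)`_0 = 1.
Hypothesis v_w : highest_lweight_vector M w v.

(** Since psi^+ has no components of negative index, the defining relation is a
finite convolution, whatever the degree. *)
Lemma lweight_plus i (m : nat) :
  \sum_(k < m.+1) ((w i)`_k * q ^+ k) *: psi true i (m%:Z - k%:Z) v
  = (q ^+ (size (w i)).-1 * ((w i)`_m * q ^- m)) *: v.
Proof.
have [_ _ /(_ true i m) <-] := v_w.
pose G (k : nat) := ((w i)`_k * q ^+ k) *: psi true i (m%:Z - k%:Z) v.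
rewrite -!(big_mkord xpredT G).
have [ms|sm] := leqP m.+1 (size (w i)).
  rewrite (big_cat_nat (n := m.+1) (leq0n _) ms) //= [X in _ + X]big_nat_cond.
  rewrite [X in _ + X]big1 ?addr0 // => k /andP[/andP[mk _] _].
  by rewrite /G qpsi_plus_neg ?scaler0 //; lia.
rewrite (big_cat_nat (n := size (w i)) (leq0n _) (ltnW sm)) //= [X in _ + X]big_nat_cond.
rewrite [X in _ + X]big1 ?addr0 // => k /andP[/andP[mk _] _].
by rewrite /G nth_default // mul0r scale0r.
Qed.

Lemma lweight_plus0 i : psi true i 0 v = q ^ ((size (w i)).-1%:Z) *: v.
Proof.
have := lweight_plus i 0.
by rewrite big_ord1 w_0 expr0 !mul1r invr1 mulr1 subrr scale1r.
Qed.

(** The eigenvector property is solved for recursively: from the constant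
coefficient for psi^+, from the leading one for psi^-. *)
Lemma lweight_line e i r : psi e i r v \in <[v]>%VS.
Proof.
case: e.
  have [r0|r0] := ltP r 0; first by rewrite qpsi_plus_neg ?mem0v.
  case: r r0 => // m _; elim/ltn_ind: m => m IH.
  have := lweight_plus i m; rewrite big_ord_recl /= w_0 mul1r expr0 scale1r subr0.
  move/(canRL (addrK _)) => ->; rewrite memvB ?memvZ ?memv_line //.
  apply: memv_suml => k _; rewrite memvZ // /bump /=.
  have -> : m%:Z - (1 + k)%N%:Z = (m - k.+1)%N by have := ltn_ord k; lia.
  by apply: IH; have := ltn_ord k; lia.
have [r0|r0] := ltP 0 r; first by rewrite qpsi_minus_pos ?mem0v.
have [N ->] : exists N : nat, r = - N%:Z by exists `|r|%N; lia.
elim/ltn_ind: N {r r0} => N IH.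
have w0 : w i != 0 by apply: contra_eqN (w_0 i) => /eqP ->; rewrite coef0 eq_sym oner_eq0.
have [_ _ /(_ false i ((size (w i)).-1%:Z - N%:Z))] := v_w.
have lead : (w i)`_(size (w i)).-1 * q ^+ (size (w i)).-1 != 0.
  by rewrite mulf_neq0 ?expf_neq0 // -/(lead_coef _) lead_coef_eq0.
rewrite -(prednK (n := size (w i))) ?size_poly_gt0 // big_ord_recr /=.
set d := (size (w i)).-1 in lead *.
have -> : d%:Z - N%:Z - d%:Z = - N%:Z by lia.
move/(canRL (addKr _)) => e; rewrite -(memvZ_neq0 _ _ lead) e.
rewrite addrC memvB ?memvZ ?memv_line //.
apply: memv_suml => k _; rewrite memvZ //.
have [h|h] := leqP (d - k) N; last first.
  by rewrite qpsi_minus_pos ?mem0v //; have := ltn_ord k; lia.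
have -> : d%:Z - N%:Z - k%:Z = - (N - (d - k))%N%:Z by have := ltn_ord k; lia.
by apply: IH; have := ltn_ord k; lia.
Qed.

End LWeightOfVector.

(** In the relation for the index m > 0 the coefficient of degree m appears on
both sides, with the factors q^m and q^-m.  These differ, so it is
determined by the lower coefficients. *)
Lemma lweight_of_vector_unique v (w w' : lweight F n) :
  (forall i, (w i)`_0 = 1) -> (forall i, (w' i)`_0 = 1) ->
  highest_lweight_vector M w v -> highest_lweight_vector M w' v -> w = w'.
Proof.
move=> w0 w'0 vw vw'; have v0 : v != 0 by case: vw.
apply/ffunP => i.
have dE : q ^ (size (w i)).-1%:Z = q ^ (size (w' i)).-1%:Z.
  by apply: (scale_vector_inj v0); rewrite -!(lweight_plus0 _ _ i).
apply/polyP; elim/ltn_ind => m IH.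
have [->|m0] := posnP m; first by rewrite w0 w'0.
have coefE (u : lweight F n) : (forall i, (u i)`_0 = 1) -> highest_lweight_vector M u v ->
    \sum_(k < m) ((u i)`_k * q ^+ k) *: psi true i (m%:Z - k%:Z) v
    = ((u i)`_m * (q ^ (size (u i)).-1%:Z * (q ^- m - q ^+ m))) *: v.
  move=> u0 vu; have := lweight_plus vu i m.
  rewrite big_ord_recr /= subrr (lweight_plus0 u0 vu) => /(canRL (addrK _)) ->.
  by rewrite scalerA -scalerBl -exprnP; congr (_ *: _); ring.
have := coefE w' w'0 vw'; rewrite -dE.
have <- : \sum_(k < m) ((w i)`_k * q ^+ k) *: psi true i (m%:Z - k%:Z) v
        = \sum_(k < m) ((w' i)`_k * q ^+ k) *: psi true i (m%:Z - k%:Z) v.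
  by apply: eq_bigr => k _; rewrite IH.
rewrite (coefE w) // => /(scale_vector_inj v0); apply: mulIf.
rewrite mulf_neq0 ?expfz_neq0 // subr_eq0 exprnN exprnP.
by apply/eqP => /(expfz_inj q_neq0 q_nroot); lia.
Qed.

Lemma highest_lweight_unique v v' (w w' : lweight F n) : qloop_simple M ->
  (forall i, (w i)`_0 = 1) -> (forall i, (w' i)`_0 = 1) ->
  highest_lweight_vector M w v -> highest_lweight_vector M w' v' -> w = w'.
Proof.
move=> simpleM w0 w'0 vw vw'; apply: (lweight_of_vector_unique w0 w'0 vw).
case: (vw) (vw') => v0 xp_v _ [v'0 xp_v' psi_v'].
have [c c0 v'E] := highest_vector_line v0 v'0 simpleM
  (lweight_line w0 vw) xp_v (lweight_line w'0 vw') xp_v'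
  (lweight_plus0 w0 vw) (lweight_plus0 w'0 vw').
have vE : v = c^-1 *: v' by rewrite v'E scalerK.
split => // e i m; rewrite vE [RHS]scalerA mulrC -scalerA -(psi_v' e i m) scaler_sumr.
by apply: eq_bigr => k _; rewrite linearZ /= !scalerA mulrC.
Qed.

End HighestWeight.

(** * Graphs over an l-weight *)

Section Graphs.
Variables (F : fieldType) (q : F) (n : nat).
Hypothesis q_neq0 : q != 0.
Hypothesis q_nroot : forall m : nat, (0 < m)%N -> q ^+ m != 1.

Lemma snake_weight_codom l (i : l.-tuple 'I_n) (a : l.-tuple int) :
  snake_weight q i a = lweight_of q (codom (fun k => (tnth i k, tnth a k))).
Proof. by rewrite /lweight_of big_map big_enum. Qed.

Lemma prime_snake_totally_ordered l (i : l.-tuple 'I_n) (a : l.-tuple int)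
    (T : finType) (A : rel T) (Fm : T -> lweight F n) :
  prime_snake i a -> pseudo_qfact_graph_over q (snake_weight q i a) A Fm ->
  totally_ordered A.
Proof.
move=> snake [[_ FmKR AP] Fm_prod].
have [i' /fin_all_exists[a' /fin_all_exists[r' Fm_E]]] := fin_all_exists FmKR.
apply: (@snake_totally_ordered n l (fun k => (tnth i k, tnth a k)) snake T A i' a' r').
- by move=> v; case: (Fm_E v).
- by move=> v w R; apply/(AP v w _ _ _ _ _ _ _ _ (Fm_E v).2 (Fm_E w).2);
    rewrite ?(Fm_E v).1 ?(Fm_E w).1.
- apply: (lweight_of_inj q_neq0 q_nroot).
  rewrite -snake_weight_codom -Fm_prod lweight_of_flatten.
  by apply: eq_bigr => v _; rewrite -KR_weightE (Fm_E v).2.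
Qed.

(** The arrows of a graph are specified for all presentations of its vertices
as Kirillov-Reshetikhin weights; a fundamental weight has only one. *)
Lemma KR_weight_fundamental (i j : 'I_n) (a b : int) r :
  KR_weight q i a r = fundamental q j b -> [/\ i = j, a = b & r = 1%N].
Proof.
move=> e; have : perm_eq (KR_string i a r) [:: (j, b)].
  apply: (lweight_of_inj q_neq0 q_nroot).
  by rewrite -KR_weightE e /lweight_of big_seq1.
move=> p; have := perm_size p; rewrite size_map size_iota => r1.
by move: p; rewrite r1 => /perm_mem/(_ (j, b)); rewrite !inE eqxx => /eqP[-> ->]; split => //; ring.
Qed.

Lemma fundamental_graph l (f : 'I_l -> 'I_n * int) : (0 < l)%N ->
  pseudo_qfact_graph_over q (lweight_of q (codom f)) (fundamental_arrow f)
    (fun k => fundamental q (f k).1 (f k).2).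
Proof.
move=> l0; split; last by rewrite /lweight_of big_map big_enum.
split=> [|v|v w i j a b r s _ _ /esym/KR_weight_fundamental[-> -> ->]
  /esym/KR_weight_fundamental[-> -> ->]].
- by rewrite card_ord.
- exists (f v).1, (f v).2, 1%N; split => //.
  by rewrite /KR_weight big_ord1 mulr0 subr0 addrK.
- by split=> /in_R11P.
Qed.

Lemma totally_ordered_prime_snake (w : lweight F n) :
  in_Pplus q w -> w <> 1 ->
  (forall (T : finType) (A : rel T) (Fm : T -> lweight F n),
     pseudo_qfact_graph_over q w A Fm -> totally_ordered A) ->
  exists (l : nat) (i : l.-tuple 'I_n) (a : l.-tuple int),
    [/\ (0 < l)%N, prime_snake i a & snake_weight q i a = w].
Proof.
move=> [s0 ws0] w1 tot; pose le2 (x y : 'I_n * int) := x.2 <= y.2.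
pose s := sort le2 s0; pose f := tnth (in_tuple s).
have fs : codom f = s by apply: map_tnth_enum.
have ws : w = lweight_of q (codom f).
  by rewrite fs ws0; apply/perm_big; rewrite perm_sym perm_sort.
have l0 : (0 < size s)%N.
  rewrite lt0n; apply/eqP => /size0nil s_nil; apply: w1.
  by rewrite ws fs s_nil /lweight_of big_nil.
have f_sorted (k k' : 'I_(size s)) : (k <= k')%N -> (f k).2 <= (f k').2.
  have le2_tr : transitive le2 by move=> y x z; apply: le_trans.
  have sorted_s : sorted le2 s by apply: sort_sorted => x y; apply: le_total.
  move=> kk'; rewrite /f !(tnth_nth (f k)).
  by apply: (sorted_leq_nth le2_tr (fun x => lexx x.2) (f k) sorted_s); rewrite ?inE.
have := tot _ _ (fun k => fundamental q (f k).1 (f k).2).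
rewrite {1}ws => /(_ _ (fundamental_graph f l0)) snake.
exists (size s), [tuple (f k).1 | k < size s], [tuple (f k).2 | k < size s]; split => //.
  by move=> k k' kk'; rewrite !tnth_mktuple; apply: fundamental_snake.
rewrite snake_weight_codom ws; congr lweight_of; apply: eq_codom => k.
by rewrite !tnth_mktuple -surjective_pairing.
Qed.

End Graphs.

Theorem theorem2p4p1 (F : closedFieldType) (q : F) (n : nat)
  (charF : [pchar F] =i pred0) (q_neq0 : q != 0)
  (q_nroot : forall m : nat, (0 < m)%N -> q ^+ m != 1)
  (n_gt0 : (0 < n)%N)
  (ppi : lweight F n) (ppi_P : in_Pplus q ppi) (ppi_neq1 : ppi <> 1)
  (V : vectType F) (M : qloop_module q n V)
  (VM : is_simple_lweight_module M ppi) :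
  prime_snake_module M <->
  (forall (T : finType) (A : rel T) (Fm : T -> lweight F n),
     pseudo_qfact_graph_over q ppi A Fm -> totally_ordered A).
Proof.
split=> [[l [i [a [_ snake [_ [v' v'_snake]]]]]] T A Fm|tot].
  case: VM => simpleM [v v_ppi].
  have -> : ppi = snake_weight q i a.
    apply: (highest_lweight_unique q_neq0 q_nroot simpleM) v_ppi v'_snake => j.
      by case: ppi_P => s ->; apply: lweight_of_coef0.
    by rewrite snake_weight_codom lweight_of_coef0.
  exact: prime_snake_totally_ordered.
have [l [i [a [l0 snake ppiE]]]] :=
  totally_ordered_prime_snake q_neq0 q_nroot ppi_P ppi_neq1 tot.
by exists l, i, a; split=> //; rewrite ppiE.
Qed.
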